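(* Let $N\ge1$, $d\ge2$ and let $G_1,G_2\in\mathcal{G}_N$. (a) If $G_1\prec G_2$ (that is, $\mathcal{B}(G_1)\subseteq\mathcal{B}(G_2)$), then any SSW for $G_2$ is also an SSW for $G_1$. (b) If $G_1\sim G_2$ (that is, $\mathcal{B}(G_1)=\mathcal{B}(G_2)$), then the sets of SSWs for $G_1$ and $G_2$ coincide.
   Context: $\mathcal{G}_N$ is the set of finite connected simple undirected graphs whose edges are labelled $1,\dots,N$ (vertex sets may differ). To each label $i$ is attached $\mathcal{H}_i=\mathbb{C}^d\otimes\mathbb{C}^d$, with $\mathbb{I}_i$ its identity and $\Phi_i=|\phi^+\rangle\langle\phi^+|$, $|\phi^+\rangle=\frac1{\sqrt d}\sum_{k=0}^{d-1}|kk\rangle$. Given $G=(V,E)\in\mathcal{G}_N$, vertices are parties, and the two tensor factors of $\mathcal{H}_i$ are held by the two endpoints of edge $i$ in $G$ (which endpoint holds which factor is immaterial below, since the partial transposes of $\Phi_i$ on either factor coincide). For $S\subseteq V$ with $S\neq\emptyset,V$ (nontrivial), $\Gamma_S$ is the partial transpose (computational basis) on all factors held by parties in $S$. A Hermitian operator $W$ on $\bigotimes_{i=1}^N\mathcal{H}_i$ is fully decomposable for $G$ if for every nontrivial $S\subseteq V$ there exist positive semidefinite $P_S,Q_S$ with $W=P_S+Q_S^{\Gamma_S}$. A sub-symmetric witness (SSW) for $G$ is an operator $W=\sum_{T\subseteq\{1,\dots,N\}}w_T\bigotimes_{i\in T}\Phi_i\otimes\bigotimes_{i\notin T}(\mathbb{I}_i-\Phi_i)$,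 $w_T\in\mathbb{R}$, that is fully decomposable for $G$. $T(S)$ is the set of (labels of) edges with exactly one endpoint in $S$, called a cut. The cut space $\mathcal{B}(G)$ is the set consisting of $\emptyset$ and all cuts $T(S)$, $S$ nontrivial. *)

(* Defs.v *)
From HB Require Import structures.
From mathcomp Require Import all_boot all_order all_algebra.
From mathcomp Require Import reals complex.

Set Implicit Arguments.
Unset Strict Implicit.
Unset Printing Implicit Defensive.

Import Order.TTheory GRing.Theory Num.Theory Num.Def.

Local Open Scope ring_scope.
Local Open Scope sesquilinear_scope.

(** ** Graphs with labelled edges, and cuts *)

(* An edge is the 2-set of its endpoints, so the edge set is the image of
   [edge]; injectivity says that distinct labels name distinct edges and that
   there are no parallel edges. *)
Record lgraph (N : nat) := LGraph {
  vertex :> finType;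
  edge : 'I_N -> {set vertex};
  card_edge : forall i, #|edge i| = 2%N;
  edge_inj : injective edge;
  edge_connected :
    forall x y : vertex, connect [rel u v | [exists i, edge i == [set u; v]]] x y
}.

Definition nontrivial (V : finType) (S : {set V}) : bool :=
  (S != set0) && (S != [set: V]).

Definition cut (N : nat) (G : lgraph N) (S : {set G}) : {set 'I_N} :=
  [set i | #|edge G i :&: S| == 1%N].

Definition cut_space (N : nat) (G : lgraph N) : {set {set 'I_N}} :=
  set0 |: [set cut S | S : {set G} & nontrivial S].

Definition graph_prec (N : nat) (G1 G2 : lgraph N) : Prop :=
  cut_space G1 \subset cut_space G2.

Definition graph_sim (N : nat) (G1 G2 : lgraph N) : Prop :=
  cut_space G1 = cut_space G2.

(* [holder i false] and [holder i true] are the parties holding the first and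
   the second tensor factor of H_i. *)
Record allocation (N : nat) (G : lgraph N) := Allocation {
  holder :> 'I_N -> bool -> G;
  edge_holder : forall i, edge G i = [set holder i false; holder i true]
}.

(** ** Operators *)

(* Operators on the space C^X with orthonormal basis (|x>)_(x : X), where
   [enum_rank] orders the basis; [entry A x y] is <x|A|y>. *)
Notation op R X := ('M[R[i]]_#|{: X}|).

Definition entry (R : realType) (X : finType) (A : op R X) (x y : X) : R[i] :=
  A (enum_rank x) (enum_rank y).

Definition op_of (R : realType) (X : finType) (f : X -> X -> R[i]) : op R X :=
  \matrix_(a, b) f (enum_val a) (enum_val b).

Definition ket (R : realType) (X : finType) (x : X) : 'cV[R[i]]_#|{: X}| :=
  delta_mx (enum_rank x) 0.

Definition psd (C : numClosedFieldType) (n : nat) (A : 'M[C]_n) : Prop :=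
  A \is hermsymmx /\ forall v : 'cV[C]_n, 0 <= (v ^t* *m A *m v) 0 0.

(* Basis labels of C^d (x) C^d and of the N-fold tensor product of copies of
   it: |x> is the tensor product over i of |(x i).1> (x) |(x i).2>. *)
Notation pair_basis d := ('I_d * 'I_d)%type.
Notation net_basis N d := {ffun 'I_N -> pair_basis d}.

Definition tensor (R : realType) (N d : nat) (A : 'I_N -> op R (pair_basis d)) :
    op R (net_basis N d) :=
  op_of (fun x y : net_basis N d => \prod_(i < N) entry (A i) (x i) (y i)).

Definition phi_plus (R : realType) (d : nat) : 'cV[R[i]]_#|{: pair_basis d}| :=
  (Num.sqrt d%:R)^-1%:C%C *: \sum_(k < d) ket R (k, k).

Definition Phi (R : realType) (d : nat) : op R (pair_basis d) :=
  phi_plus R d *m (phi_plus R d) ^t*.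

(* [mix a S x y] is the label x with the coordinates of all factors held in S
   replaced by those of y. *)
Definition mix (N d : nat) (G : lgraph N) (a : allocation G) (S : {set G})
    (x y : net_basis N d) : net_basis N d :=
  [ffun i => (if a i false \in S then (y i).1 else (x i).1,
              if a i true \in S then (y i).2 else (x i).2)].

Definition ptranspose (R : realType) (N d : nat) (G : lgraph N)
    (a : allocation G) (S : {set G}) (A : op R (net_basis N d)) :
    op R (net_basis N d) :=
  op_of (fun x y : net_basis N d => entry A (mix a S x y) (mix a S y x)).

(** ** Sub-symmetric witnesses *)

Definition fully_decomposable (R : realType) (N d : nat) (G : lgraph N)
    (a : allocation G) (W : op R (net_basis N d)) : Prop :=
  W \is hermsymmx /\
  forall S : {set G}, nontrivial S ->
    exists P Q : op R (net_basis N d),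
      [/\ psd P, psd Q & W = P + ptranspose a S Q].

Definition sub_symmetric (R : realType) (N d : nat)
    (w : {set 'I_N} -> R) : op R (net_basis N d) :=
  \sum_(T : {set 'I_N})
    (w T)%:C%C *: tensor (fun i => if i \in T then Phi R d else 1%:M - Phi R d).

Definition SSW (R : realType) (N d : nat) (G : lgraph N) (a : allocation G)
    (W : op R (net_basis N d)) : Prop :=
  (exists w : {set 'I_N} -> R, W = sub_symmetric d w) /\
  fully_decomposable a W.

(* Main.v *)
Require Import Defs.
From mathcomp Require Import all_boot all_order all_algebra.
From mathcomp Require Import reals complex.
From mathcomp Require Import ring.

(** Measuring Phi_i against I_i - Phi_i on every edge and preparing the
    normalized projector of the outcome is a map D that fixes sub-symmetric
    operators and preserves positivity (it is the U (x) conj U twirl, written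
    without a Haar integral).  Applied to a decomposition W = P + Q^Gamma, it
    makes both summands sub-symmetric.  The partial transpose of a
    sub-symmetric operator depends only on the cut T(S), because Phi_i is
    invariant under the full transpose; since G1 is connected, every
    nontrivial S1 has a nonempty cut, which is then also the cut of a
    nontrivial S2 of G2.

    It remains to see that Gamma D Gamma preserves positivity.  On an edge of
    the cut, Phi becomes F/d with F the swap, and
      F/d (x) F/d + (1 - F/d) (x) (1 - F/d) / (d^2 - 1)
        = Pi+ (x) Pi+ / tr Pi+  +  Pi- (x) Pi- / tr Pi-
    where Pi+ and Pi- are the projectors onto the symmetric and antisymmetric
    subspaces: Gamma D Gamma is also a measure-and-prepare map, of Werner
    type on the edges of the cut. *)

Set Implicit Arguments.
Unset Strict Implicit.
Unset Printing Implicit Defensive.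

Import Order.TTheory GRing.Theory Num.Theory.

Local Open Scope ring_scope.
Local Open Scope sesquilinear_scope.

(** * Positive semidefinite matrices and projectors *)

Lemma hermsymmxP (C : numClosedFieldType) n (A : 'M[C]_n) :
  reflect (A = A ^t*) (A \is hermsymmx).
Proof. by apply: (iffP (is_hermitianmxP _ _ _)); rewrite expr0 scale1r. Qed.

Definition projector (C : numClosedFieldType) n (A : 'M[C]_n) : Prop :=
  A ^t* = A /\ A *m A = A.

Section Positivity.
Variables (C : numClosedFieldType) (n : nat).
Implicit Types A B : 'M[C]_n.

Lemma psd0 : psd (0 : 'M[C]_n).
Proof.
split; first by apply/hermsymmxP; rewrite trmx0 map_mx0.
by move=> v; rewrite mulmx0 mul0mx mxE.
Qed.

Lemma psdD A B : psd A -> psd B -> psd (A + B).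
Proof.
move=> [/hermsymmxP hA pA] [/hermsymmxP hB pB]; split.
  by apply/hermsymmxP; rewrite linearD map_mxD -hA -hB.
by move=> v; rewrite mulmxDr mulmxDl mxE addr_ge0.
Qed.

Lemma psdZ (c : C) A : 0 <= c -> psd A -> psd (c *: A).
Proof.
move=> c0 [/hermsymmxP hA pA]; split.
  apply/hermsymmxP; rewrite linearZ map_mxZ -hA /=.
  by rewrite (CrealP (ger0_real c0)).
by move=> v; rewrite -scalemxAr -scalemxAl mxE mulr_ge0.
Qed.

Lemma psd_sum (I : finType) (F : I -> 'M[C]_n) :
  (forall i, psd (F i)) -> psd (\sum_i F i).
Proof. by move=> pF; apply: big_ind => //; [exact: psd0 | exact: psdD]. Qed.

Lemma adjM m p q (A : 'M[C]_(m, p)) (B : 'M[C]_(p, q)) :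
  (A *m B) ^t* = B ^t* *m A ^t*.
Proof. by rewrite trmx_mul map_mxM. Qed.

Lemma psd_projector A : projector A -> psd A.
Proof.
move=> [hA iA]; split; first exact/hermsymmxP.
move=> v; rewrite -iA -{1}hA mulmxA -adjM -mulmxA mxE.
by apply: sumr_ge0 => i _; rewrite !mxE mulrC mul_conjC_ge0.
Qed.

(** Since [B] is a projector, tr(AB) = tr(BAB), whose diagonal entries are values of the form of [A]
    at the columns of [B]. *)
Lemma mxtrace_psd_projector A B : psd A -> projector B -> 0 <= \tr (A *m B).
Proof.
move=> [_ pA] [hB iB]; rewrite -iB mulmxA mxtrace_mulC mulmxA.
apply: sumr_ge0 => j _; have := pA (col j B).
suff -> : (col j B) ^t* *m A *m col j B = row j (col j (B *m A *m B)).
  by rewrite !mxE.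
by rewrite !(rowE, colE) adjM hB trmx_delta map_delta_mx !mulmxA.
Qed.

Lemma projector_subr1 A : projector A -> projector (1%:M - A).
Proof.
move=> [hA iA]; split; first by rewrite linearB /= map_mxB trmx1 map_mx1 hA.
by rewrite mulmxBl mul1mx mulmxBr mulmx1 iA subrr subr0.
Qed.

End Positivity.

(** * Operators and tensor products through their entries *)

Section Operators.
Variables (R : realType) (X : finType).
Implicit Types A B : op R X.

Lemma entryE (f : X -> X -> R[i]) x y : entry (op_of f) x y = f x y.
Proof. by rewrite /entry mxE !enum_rankK. Qed.

Lemma entryP A B : (forall x y, entry A x y = entry B x y) -> A = B.
Proof.
move=> eqAB; apply/matrixP=> a b; have := eqAB (enum_val a) (enum_val b).
by rewrite /entry !enum_valK.
Qed.

Lemma entryD A B x y : entry (A + B) x y = entry A x y + entry B x y.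
Proof. exact: mxE. Qed.

Lemma entryN A x y : entry (- A) x y = - entry A x y.
Proof. exact: mxE. Qed.

Lemma entryZ c A x y : entry (c *: A) x y = c * entry A x y.
Proof. exact: mxE. Qed.

Lemma entry1 x y : entry (1%:M : op R X) x y = (x == y)%:R.
Proof. by rewrite /entry mxE (inj_eq enum_rank_inj). Qed.

Lemma entry_sum (I : finType) (F : I -> op R X) x y :
  entry (\sum_i F i) x y = \sum_i entry (F i) x y.
Proof. exact: summxE. Qed.

Lemma entry_mulmx A B x y :
  entry (A *m B) x y = \sum_z entry A x z * entry B z y.
Proof. by rewrite /entry mxE (reindex _ (onW_bij _ (enum_rank_bij X))). Qed.

Lemma entry_adj A x y : entry (A ^t*) x y = (entry A y x)^*.
Proof. by rewrite /entry !mxE. Qed.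

Lemma trE A : \tr A = \sum_x entry A x x.
Proof. by rewrite /mxtrace (reindex _ (onW_bij _ (enum_rank_bij X))). Qed.

End Operators.

Definition entry_simp := (entryE, entryD, entryN, entryZ, entry1, entry_adj).


Section Tensors.
Variables (R : realType) (N d : nat).
Implicit Types A B : 'I_N -> op R (pair_basis d).

Lemma eq_tensor A B : A =1 B -> tensor A = tensor B.
Proof.
by move=> eqAB; apply: entryP => x y; rewrite !entryE; under eq_bigr do rewrite eqAB.
Qed.

Lemma tensorM A B : tensor A *m tensor B = tensor (fun i => A i *m B i).
Proof.
apply: entryP => x y; rewrite entry_mulmx entryE.
under [RHS]eq_bigr do rewrite entry_mulmx.
by rewrite bigA_distr_bigA; apply: eq_bigr => z _; rewrite !entryE -big_split.
Qed.

Lemma tensor_adj A : (tensor A) ^t* = tensor (fun i => (A i) ^t*).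
Proof.
apply: entryP => x y; rewrite !entry_simp rmorph_prod.
by apply: eq_bigr => i _; rewrite entry_adj.
Qed.

Lemma tr_tensor A : \tr (tensor A) = \prod_i \tr (A i).
Proof.
under [RHS]eq_bigr do rewrite trE.
by rewrite bigA_distr_bigA trE; apply: eq_bigr => z _; rewrite entryE.
Qed.

Lemma projector_tensor A : (forall i, projector (A i)) -> projector (tensor A).
Proof.
move=> pA; rewrite /projector tensorM tensor_adj.
by split; apply: eq_tensor => i; case: (pA i).
Qed.

Lemma tr_mulmx (A B : op R (net_basis N d)) :
  \tr (A *m B) = \sum_x \sum_y entry A x y * entry B y x.
Proof. by rewrite trE; apply: eq_bigr => x _; rewrite entry_mulmx. Qed.

End Tensors.

(** * Measure-and-prepare maps *)

Section MeasurePrepare.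
Variables (R : realType) (N d : nat).
Implicit Types (alpha beta : 'I_N -> bool -> R[i]).
Implicit Types (f g : 'I_N -> bool -> op R (pair_basis d)).
Implicit Types (T : {set 'I_N}) (Q : op R (net_basis N d)).

Definition choice_tensor f T : op R (net_basis N d) :=
  tensor (fun i => f i (i \in T)).

(** [alpha] and [f] stay arbitrary: projectors with nonnegative weights give a map preserving
    positivity, and their partial transposes, which may fail to be positive, give its conjugate by
    Gamma. *)
Definition measure_prepare alpha f Q : op R (net_basis N d) :=
  \sum_(T : {set 'I_N})
    ((\prod_i alpha i (i \in T)) * \tr (Q *m choice_tensor f T))
      *: choice_tensor f T.

Lemma measure_prepareD alpha f P Q :
  measure_prepare alpha f (P + Q)
    = measure_prepare alpha f P + measure_prepare alpha f Q.
Proof.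
rewrite -big_split; apply: eq_bigr => T _.
by rewrite /= mulmxDl mxtraceD mulrDr scalerDl.
Qed.

Lemma psd_measure_prepare alpha f Q :
  (forall i b, 0 <= alpha i b) -> (forall i b, projector (f i b)) ->
  psd Q -> psd (measure_prepare alpha f Q).
Proof.
move=> a0 pf pQ; apply: psd_sum => T.
have pT : projector (choice_tensor f T) by apply: projector_tensor.
apply: psdZ (psd_projector pT); apply: mulr_ge0; first exact: prodr_ge0.
exact: mxtrace_psd_projector.
Qed.

(* [measure_prepare] depends on [alpha] and [f] only through the tensor
   [\sum_b alpha b *: f b (x) f b] of each site, and this tensor can have
   several decompositions. *)
Lemma eq_measure_prepare alpha f beta g Q :
  (forall i x y u v,
     \sum_b alpha i b * (entry (f i b) x y * entry (f i b) u v)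
     = \sum_b beta i b * (entry (g i b) x y * entry (g i b) u v)) ->
  measure_prepare alpha f Q = measure_prepare beta g Q.
Proof.
have kernel al h x y : entry (measure_prepare al h Q) x y =
    \sum_u \sum_v entry Q u v * \prod_i \sum_b
      al i b * (entry (h i b) (v i) (u i) * entry (h i b) (x i) (y i)).
  rewrite entry_sum.
  under eq_bigr do rewrite entryZ tr_mulmx mulr_sumr mulr_suml.
  rewrite exchange_big; apply: eq_bigr => u _ /=.
  under eq_bigr do rewrite mulr_sumr mulr_suml.
  rewrite exchange_big; apply: eq_bigr => v _ /=.
  (* Choosing an option at each site amounts to choosing the set T of sites with [true], so a
     product of two-term sums expands into a sum over T. *)
  under [in RHS]eq_bigr do rewrite big_bool.
  rewrite bigA_distr mulr_sumr; apply: eq_bigr => T _.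
  rewrite !entryE -!mulrA mulrCA; congr (_ * _).
  by rewrite -!big_split; apply: eq_bigr => i _ /=; case: (i \in T).
move=> fg; apply: entryP => x y; rewrite !kernel.
apply: eq_bigr => u _; apply: eq_bigr => v _; congr (_ * _).
by apply: eq_bigr => i _.
Qed.

(** The choice tensors are orthogonal for the trace form: where U and T differ at a site, the
    weighted factor vanishes. For U = T, [alpha] cancels the norm. *)
Lemma measure_prepare_fix alpha f (w : {set 'I_N} -> R[i]) :
  (forall i b c, alpha i b * \tr (f i c *m f i b) = (c == b)%:R) ->
  measure_prepare alpha f (\sum_T w T *: choice_tensor f T)
    = \sum_T w T *: choice_tensor f T.
Proof.
move=> orth; apply: eq_bigr => T _; congr (_ *: _).
rewrite mulmx_suml raddf_sum mulr_sumr (bigD1 T) //= [X in _ + X]big1; last first.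
  move=> U neUT; rewrite -scalemxAl mxtraceZ mulrCA tensorM tr_tensor -big_split.
  have [i neq] : exists i, (i \in U) != (i \in T).
    apply/existsP; apply: contraNT neUT; rewrite negb_exists => /forallP eqUT.
    by apply/eqP/setP => i; apply/eqP; have := eqUT i; rewrite negbK.
  by rewrite (bigD1 i) //= orth (negPf neq) mul0r mulr0.
rewrite addr0 -scalemxAl mxtraceZ mulrCA tensorM tr_tensor -big_split.
by rewrite big1 ?mulr1 // => i _ /=; rewrite orth eqxx.
Qed.

End MeasurePrepare.


(** * Cuts and partial transposes *)

Lemma card_set2I (T : finType) (u v : T) (S : {set T}) :
  #|[set u; v]| = 2 -> (#|[set u; v] :&: S| == 1)%N = (u \in S) (+) (v \in S).
Proof.
rewrite cards2; have [//|neuv _] := eqVneq u v.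
rewrite (cardsD1 u) (cardsD1 v) (_ : _ :\ u :\ v = set0) ?cards0.
  rewrite !inE !eqxx (eq_sym v) neuv orbT /=.
  by case: (u \in S); case: (v \in S).
by apply/setP => z; rewrite !inE; case: (z == u); case: (z == v).
Qed.

Section PartialTranspose.
Variables (R : realType) (N d : nat) (G : lgraph N) (a : allocation G).
Implicit Types (S : {set G}) (A B : op R (net_basis N d)).

Lemma mixK S (x y : net_basis N d) : mix a S (mix a S x y) (mix a S y x) = x.
Proof.
apply/ffunP => i; rewrite !ffunE /=.
by case: (a i false \in S); case: (a i true \in S); case: (x i).
Qed.

Lemma ptransposeK S : involutive (@ptranspose R N d G a S).
Proof. by move=> A; apply: entryP => x y; rewrite !entryE !mixK. Qed.

(** Exchanging the coordinates held in S between x and y is an involution on pairs of labels, which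
    reindexes the double sum. *)
Lemma tr_ptranspose S A B :
  \tr (ptranspose a S A *m B) = \tr (A *m ptranspose a S B).
Proof.
rewrite !tr_mulmx !pair_big /=.
pose h (p : net_basis N d * net_basis N d) := (mix a S p.1 p.2, mix a S p.2 p.1).
have hK : involutive h by case=> x y; rewrite /h /= !mixK.
rewrite [RHS](reindex_inj (inv_inj hK)); apply: eq_bigr => -[x y] _ /=.
by rewrite !entryE !mixK.
Qed.

Lemma ptranspose_sum S (I : finType) (c : I -> R[i]) (F : I -> op R (net_basis N d)) :
  ptranspose a S (\sum_i c i *: F i) = \sum_i c i *: ptranspose a S (F i).
Proof.
apply: entryP => x y; rewrite entryE !entry_sum.
by apply: eq_bigr => i _; rewrite !entry_simp.
Qed.

Definition pair_mix (s t : bool) (x y : pair_basis d) : pair_basis d :=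
  (if s then y.1 else x.1, if t then y.2 else x.2).

Lemma ptranspose_tensor S (A B : 'I_N -> op R (pair_basis d)) :
  (forall i x y,
     let m := pair_mix (a i false \in S) (a i true \in S) in
     entry (A i) (m x y) (m y x) = entry (B i) x y) ->
  ptranspose a S (tensor A) = tensor B.
Proof.
move=> AB; apply: entryP => x y; rewrite !entryE.
by apply: eq_bigr => i _; rewrite -AB !ffunE.
Qed.

Lemma in_cut S i : (i \in cut S) = (a i false \in S) (+) (a i true \in S).
Proof.
by rewrite inE (edge_holder a) card_set2I // -edge_holder card_edge.
Qed.

(** If the cut were empty, S would be closed under adjacency and, by connectedness, contain every
    vertex. *)
Lemma cut_neq0 S : nontrivial S -> cut S != set0.
Proof.
case/andP=> /set0Pn[x xS] SnT; apply: contra SnT => /eqP cut0.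
rewrite -subTset; apply/subsetP => y _.
rewrite -(@closed_connect _ _ (mem S) _ _ _ (edge_connected x y)) // => u v.
case/existsP => i /eqP iuv; have := in_set0 i; rewrite -cut0 inE iuv.
by rewrite card_set2I -?iuv ?card_edge // => /negbT; rewrite addbC negb_add => /eqP.
Qed.

End PartialTranspose.

(** * Bell and Werner operators on one edge *)

Section Edge.
Variables (R : realType) (d : nat).
Hypothesis d_gt1 : (1 < d)%N.

Let D : R[i] := d%:R.
Let D0 : D != 0. Proof. by rewrite pnatr_eq0 -lt0n ltnW. Qed.
Let Dm1 : D - 1 != 0. Proof. by rewrite subr_eq0 pnatr_eq1 gtn_eqF. Qed.
Let Dp1 : D + 1 != 0. Proof. by rewrite natr1 pnatr_eq0. Qed.

Lemma entry_Phi (x y : pair_basis d) :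
  entry (Phi R d) x y = D^-1 * ((x.1 == x.2)%:R * (y.1 == y.2)%:R).
Proof.
have phiE (z : pair_basis d) : phi_plus R d (enum_rank z) 0
    = (Num.sqrt d%:R)^-1%:C%C * (z.1 == z.2)%:R.
  rewrite /phi_plus mxE summxE; congr (_ * _).
  under eq_bigr do rewrite mxE (inj_eq enum_rank_inj) andbT.
  case: z => z1 z2 /=; rewrite (bigD1 z1) //= big1 => [|k /negPf nek].
    by rewrite addr0 xpair_eqE eqxx /= eq_sym.
  by rewrite xpair_eqE eq_sym nek.
rewrite /entry /Phi mxE big_ord1 2![in X in _ * X]mxE !phiE rmorphM rmorph_nat.
rewrite mulrACA; congr (_ * _).
set c := (_^-1 : R).
transitivity (c%:C%C * c%:C%C : R[i]); first by congr (_ * _); exact: conjc_real.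
by rewrite -rmorphM -invfM -expr2 sqr_sqrtr ?ler0n // fmorphV rmorph_nat.
Qed.

(** The swap divided by d, which is the partial transpose of Phi on either factor. *)
Definition half_swap : op R (pair_basis d) :=
  op_of (fun x y => d%:R^-1 * ((x.1 == y.2)%:R * (y.1 == x.2)%:R)).

Definition bell (b : bool) : op R (pair_basis d) :=
  if b then Phi R d else 1%:M - Phi R d.

(** [bell_pt true] has the negative eigenvalue -1/d, so positivity has to be read off another
    decomposition. *)
Definition bell_pt (b : bool) : op R (pair_basis d) :=
  if b then half_swap else 1%:M - half_swap.

(* [d *: half_swap] is the swap, so these are the projections onto the
   symmetric ([b = true]) and antisymmetric subspaces. *)
Definition sym_proj (b : bool) : op R (pair_basis d) :=
  2^-1 *: (1%:M + (if b then d%:R else - d%:R) *: half_swap).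

(** Inverse traces of [bell b], whose ranks are 1 and d^2 - 1. *)
Definition bell_weight (b : bool) : R[i] := if b then 1 else (d%:R ^+ 2 - 1)^-1.

(** Inverse traces of [sym_proj b], whose ranks are d(d + 1)/2 and d(d - 1)/2. *)
Definition sym_weight (b : bool) : R[i] :=
  2 / (d%:R * (if b then d%:R + 1 else d%:R - 1)).

Lemma bell_weight_ge0 b : 0 <= bell_weight b.
Proof.
case: b; rewrite /bell_weight ?ler01 // invr_ge0 subr_ge0 -natrX ler1n.
by rewrite expn_gt0 ltnW.
Qed.

Lemma sym_weight_ge0 b : 0 <= sym_weight b.
Proof.
apply: divr_ge0; rewrite ?ler0n // mulr_ge0 ?ler0n //.
by case: b; rewrite ?subr_ge0 ?ler1n 1?ltnW // natr1 ler0n.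
Qed.

Lemma sum_diag : \sum_(z : pair_basis d) (z.1 == z.2)%:R = D.
Proof.
rewrite -(pair_bigA _ (fun i j : 'I_d => (i == j)%:R)) /=.
under eq_bigr => i _.
  rewrite (bigD1 i) //= big1 ?addr0 ?eqxx => [|j]; last by rewrite eq_sym => /negPf->.
  over.
by rewrite sumr_const card_ord.
Qed.

Lemma projector_Phi : projector (Phi R d).
Proof.
split; apply: entryP => x y.
  rewrite entry_adj !entry_Phi !rmorphM fmorphV !rmorph_nat.
  by rewrite [X in _ * X]mulrC.
rewrite entry_mulmx; under eq_bigr do rewrite !entry_Phi.
transitivity (\sum_(z : pair_basis d)
   (z.1 == z.2)%:R * (D^-1 ^+ 2 * ((x.1 == x.2)%:R * (y.1 == y.2)%:R))).
  by apply: eq_bigr => z _; case: (z.1 == z.2); rewrite /=; ring.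
by rewrite -mulr_suml sum_diag entry_Phi; field.
Qed.

Lemma tr_Phi : \tr (Phi R d) = 1.
Proof.
rewrite trE; under eq_bigr do rewrite entry_Phi -natrM mulnb andbb.
by rewrite -mulr_sumr sum_diag mulVf.
Qed.

Lemma projector_bell b : projector (bell b).
Proof.
by case: b; [exact: projector_Phi | apply: projector_subr1 projector_Phi].
Qed.

Lemma bell_orth b c :
  bell_weight b * \tr (bell c *m bell b) = (c == b)%:R.
Proof.
have [_ idP] := projector_Phi; have [_ idQ] := projector_bell false.
case: b c => [] [] /=; rewrite ?idP ?idQ ?mulmxBl ?mulmxBr ?mul1mx ?mulmx1 ?idP ?subrr.
- by rewrite tr_Phi mulr1.
- by rewrite mxtrace0 mulr0.
- by rewrite mxtrace0 mulr0.
- rewrite /bell raddfB /= mxtrace1 tr_Phi card_prod card_ord natrM.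
  by rewrite -expr2 mulVf // subr_sqr_1 mulf_neq0.
Qed.

Lemma projector_sym b : projector (sym_proj b).
Proof.
have swapE x y : entry half_swap x y = D^-1 * (x == (y.2, y.1))%:R.
  by case: x => x1 x2; rewrite entryE xpair_eqE /= -natrM mulnb [y.1 == _]eq_sym.
have hS : half_swap ^t* = half_swap.
  apply: entryP => x y; rewrite !entry_simp !rmorphM fmorphV !rmorph_nat.
  by rewrite [(y.1 == _)%:R * _]mulrC.
have SS : half_swap *m half_swap = (D^-1 ^+ 2)%:M.
  apply: entryP => x y; rewrite entry_mulmx -scalemx1 !entry_simp.
  under eq_bigr do rewrite !swapE.
  case: y => y1 y2; rewrite (bigD1 (y2, y1)) //= big1 => [|z /negPf->].
    by rewrite eqxx /= addr0 mulr1 mulrAC expr2.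
  by rewrite !mulr0.
pose c : R[i] := if b then D else - D.
(* [c *: half_swap] is plus or minus the swap, whose square is the identity. *)
have cc : c * c * D^-1 ^+ 2 = 1 by rewrite /c; case: (b); field.
rewrite /projector /sym_proj -/D -/c; split.
  rewrite linearZ map_mxZ linearD map_mxD linearZ map_mxZ /= hS trmx1 map_mx1.
  rewrite fmorphV rmorph_nat; congr (_ *: (_ + _ *: _)).
  by rewrite /c; case: (b); rewrite ?rmorphN rmorph_nat.
rewrite -scalemxAl -scalemxAr mulmxDl !mulmxDr !mul1mx mulmx1.
rewrite -scalemxAl -scalemxAr SS !scale_scalar_mx mulrA cc.
apply: entryP => x y; rewrite !entry_simp.
by field.
Qed.

(** With F the swap, both sides expand to the entries of (1 (x) 1 + F (x) F - (1 (x) F + F (x) 1)/d)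
    / (d^2 - 1). *)
Lemma bell_pt_kernel (x y u v : pair_basis d) :
  \sum_b bell_weight b * (entry (bell_pt b) x y * entry (bell_pt b) u v)
  = \sum_b sym_weight b * (entry (sym_proj b) x y * entry (sym_proj b) u v).
Proof.
rewrite !big_bool /= /bell_weight /sym_weight /sym_proj !entryZ !entryD !entryN !entryZ.
rewrite -/D; move: (entry half_swap x y) (entry half_swap u v).
move: (entry 1%:M x y) (entry 1%:M u v) => e f p q.
have D2 : D ^+ 2 - 1 != 0 by rewrite subr_sqr_1 mulf_neq0.
by field; rewrite D0 Dm1 Dp1 D2.
Qed.

(** The identity and Phi are symmetric matrices, so transposing both factors changes nothing;
    transposing one fixes the identity and turns Phi into [half_swap]. *)
Lemma bell_mix b s t (x y : pair_basis d) :
  entry (bell b) (pair_mix s t x y) (pair_mix s t y x)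
  = entry (if s (+) t then bell_pt b else bell b) x y.
Proof.
have mix1 : entry (1%:M : op R (pair_basis d)) (pair_mix s t x y) (pair_mix s t y x)
            = entry 1%:M x y.
  rewrite !entry1 !xpair_eqE; case: x y => x1 x2 [y1 y2] /=.
  by case: s; case: t; rewrite /= ?[y1 == _]eq_sym ?[y2 == _]eq_sym.
have mixP : entry (Phi R d) (pair_mix s t x y) (pair_mix s t y x)
            = entry (if s (+) t then half_swap else Phi R d) x y.
  rewrite entry_Phi; case: x y {mix1} => x1 x2 [y1 y2].
  case: s; case: t; rewrite /= ?entry_Phi ?entryE //=.
  - by rewrite [X in _ * X]mulrC.
  - by rewrite [X in _ * X]mulrC.
by case: b; rewrite /= ?entryD ?entryN ?mix1 mixP; case: (s (+) t); rewrite ?entryD ?entryN.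
Qed.

End Edge.

(** * Transfer of decompositions between graphs *)

Section Transfer.
Variables (R : realType) (N d : nat).
Hypothesis d_gt1 : (1 < d)%N.

(** The right-hand side sees the graph only through the cut, so sets of different graphs with equal
    cuts are interchangeable. *)
Lemma ptranspose_bell (G : lgraph N) (a : allocation G) (S : {set G}) T :
  ptranspose a S (choice_tensor (fun=> @bell R d) T)
  = choice_tensor (fun i => if i \in cut S then @bell_pt R d else @bell R d) T.
Proof.
apply: ptranspose_tensor => i x y /=; rewrite bell_mix (in_cut a).
by case: (_ (+) _).
Qed.

Lemma SSW_transfer (G1 G2 : lgraph N) (a1 : allocation G1) (a2 : allocation G2)
    (W : op R (net_basis N d)) :
  graph_prec G1 G2 -> SSW a2 W -> SSW a1 W.
Proof.
move=> /subsetP sub12 [[w defW] [hermW decW]]; split; first by exists w.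
split=> // S1 S1nt.
have : cut S1 \in cut_space G2.
  by apply: sub12; apply/setU1P; right; apply/imsetP; exists S1; rewrite ?inE.
case/setU1P => [cut0|/imsetP[S2]]; last rewrite inE => S2nt cut12.
  by have := cut_neq0 S1nt; rewrite cut0 eqxx.
have [P [Q [psdP psdQ defPQ]]] := decW S2 S2nt.
pose ga (_ : 'I_N) := @bell_weight R d; pose fa (_ : 'I_N) := @bell R d.
(* [K] is Gamma_S1 D Gamma_S2 applied to [Q], with Gamma_S2 moved across the trace; hence Gamma_S1
   of [K] is D of the second summand of [W]. *)
pose K := \sum_(T : {set 'I_N})
  ((\prod_i ga i (i \in T)) * \tr (Q *m ptranspose a2 S2 (choice_tensor fa T)))
    *: ptranspose a1 S1 (choice_tensor fa T).
have W_fix : measure_prepare ga fa W = W.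
  by rewrite defW; apply: measure_prepare_fix => i b c; apply: bell_orth.
exists (measure_prepare ga fa P), K; split.
- apply: psd_measure_prepare psdP => i b; first exact: bell_weight_ge0.
  exact: projector_bell.
- pose g i := if i \in cut S2 then @bell_pt R d else @bell R d.
  pose be i := if i \in cut S2 then @sym_weight R d else @bell_weight R d.
  pose h i := if i \in cut S2 then @sym_proj R d else @bell R d.
  have -> : K = measure_prepare ga g Q.
    by apply: eq_bigr => T _; rewrite !ptranspose_bell cut12.
  (* On the cut, [bell_pt] gives way to the projectors [sym_proj] with nonnegative weights. *)
  rewrite (@eq_measure_prepare _ _ _ _ _ be h).
    apply: psd_measure_prepare psdQ => i b; rewrite /be /h; case: ifP => _.
    + exact: sym_weight_ge0.
    + exact: bell_weight_ge0.
    + exact: projector_sym.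
    + exact: projector_bell.
  move=> i x y u v; rewrite /ga /g /be /h; case: ifP => // _.
  exact: bell_pt_kernel.
- rewrite -{1}W_fix defPQ measure_prepareD ptranspose_sum; congr (_ + _).
  by apply: eq_bigr => T _; rewrite ptransposeK tr_ptranspose.
Qed.

End Transfer.

Theorem mainTheorem3 (R : realType) (N d : nat) (hN : (1 <= N)%N) (hd : (2 <= d)%N)
    (G1 G2 : lgraph N) (a1 : allocation G1) (a2 : allocation G2) :
  (graph_prec G1 G2 ->
     forall W : op R (net_basis N d), SSW a2 W -> SSW a1 W) /\
  (graph_sim G1 G2 ->
     forall W : op R (net_basis N d), SSW a1 W <-> SSW a2 W).
Proof.
split=> [prec W | sim W]; first exact: SSW_transfer.
by split; apply: SSW_transfer; rewrite // /graph_prec sim.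
Qed.
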